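(* Given $A=\begin{pmatrix}a&b\\c&d\end{pmatrix}$ we have that \begin{align*} \operatorname{Trace} S^kA&=\sum_{i=0}^{\lfloor \frac{k}{2}\rfloor}(-1)^i\binom{k-i}{i}(a+d)^{k-2i}(ad-bc)^i\\ &=\sum_{j=0}^{k}\sum_{i=0}^{\min\{k-j,j\}}\binom{k-j}{i}\binom{j}{j-i} a^{k-j-i}b^{i}c^{i}d^{j-i}\\ &=\sum_{s=0}^{\lfloor\frac{k}{2}\rfloor}\sum_{m=0}^{k-2s}\binom{k-s-m}{s}\binom{m+s}{m} a^{k-2s-m}b^{s}c^{s}d^{m}\\ &=\frac{1}{2}\left(\frac{a+d}{2}\right)^{k}\frac{\bigl(1+\sqrt{1-4(ad-bc)/(a+d)^2}\bigr)^{k+1}-\bigl(1-\sqrt{1-4(ad-bc)/(a+d)^2}\bigr)^{k+1}}{\sqrt{1-4(ad-bc)/(a+d)^2}}. \end{align*}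
   Context: Here $A=\begin{pmatrix}a&b\\c&d\end{pmatrix}$ is a $2\times2$ matrix with complex entries and $k\ge 0$ is an integer. $S^k\mathbb{C}^2$ denotes the $k$-th symmetric power of $\mathbb{C}^2$, identified with the vector space of homogeneous polynomials of degree $k$ in two variables $x,y$, with basis $P_j(x,y)=x^{k-j}y^{j}$, $0\le j\le k$. The $k$-th symmetric power $S^kA$ of $A$ is the matrix, with respect to this basis, of the linear action of $A$ on $S^k\mathbb{C}^2$ given by $(A\cdot P)(x,y)=P(ax+cy,\,bx+dy)$. $\operatorname{Trace} S^kA$ is its trace, and $\lfloor x\rfloor$ denotes the floor of $x$. *)

(* Defs.v *)
From HB Require Import structures.
From mathcomp Require Import all_boot all_order all_algebra.
From mathcomp Require Import mpoly complex reals.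

Set Implicit Arguments.
Unset Strict Implicit.
Unset Printing Implicit Defensive.

Import Order.TTheory GRing.Theory Num.Theory.
Local Open Scope ring_scope.

Section SymmetricPower.
Variables (F : fieldType) (k : nat).

(* The variables x and y are 'X_0 and 'X_1; [dhomog 2 F k] is the vector
   space of homogeneous polynomials of degree k in them. *)

(* The pair (a x + c y, b x + d y), i.e. the row vector (x, y) times A. *)
Definition lin_subst (A : 'M[F]_2) : 2.-tuple {mpoly F[2]} :=
  [tuple A 0 0 *: 'X_0 + A 1 0 *: 'X_1; A 0 1 *: 'X_0 + A 1 1 *: 'X_1].

Lemma lin_subst_homog A (p : {mpoly F[2]}) :
  p \is k.-homog -> p \mPo lin_subst A \is k.-homog.
Proof.
move=> /dhomogP hp; rewrite comp_mpolyE big_seq rpred_sum // => m mp.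
have X_homog (i : 'I_2) : ('X_i : {mpoly F[2]}) \is 1.-homog.
  by rewrite dhomogX /= mdeg1.
have hs i : tnth (lin_subst A) i \is 1.-homog.
  have [->|->] : i = 0 \/ i = 1.
    by case: i => [[|[|//]] hi]; [left|right]; apply/val_inj.
    by rewrite /tnth /=; apply: rpredD; apply: rpredZ.
  by rewrite /tnth /=; apply: rpredD; apply: rpredZ.
have hpow i e : tnth (lin_subst A) i ^+ e \is e.-homog.
  by have := dhomogMn e (hs i); rewrite mul1n.
apply: rpredZ; rewrite -(hp m mp) big_ord_recl big_ord1 /= mdegE.
by rewrite big_ord_recl big_ord1 dhomogM.
Qed.

(* (A . P)(x, y) = P(a x + c y, b x + d y) *)
Definition sym_act (A : 'M[F]_2) (p : dhomog 2 F k) : dhomog 2 F k :=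
  DHomog (lin_subst_homog A (dhomog_is_dhomog p)).

Lemma sym_act_is_linear A : linear (sym_act A).
Proof. by move=> c p q; apply/val_inj; rewrite /= comp_mpolyD comp_mpolyZ. Qed.

HB.instance Definition _ A :=
  GRing.isLinear.Build F (dhomog 2 F k) (dhomog 2 F k) _ (sym_act A)
    (sym_act_is_linear A).

Lemma monom_homog (j : 'I_k.+1) :
  'X_0 ^+ (k - j) * 'X_1 ^+ j \is [in F[2], k.-homog].
Proof.
rewrite !mpolyXn -mpolyXD dhomogX /= mdegD !mdegMn !mdeg1 !mul1n.
by rewrite subnK // -ltnS.
Qed.

(* P_j = x ^ (k - j) y ^ j for 0 <= j <= k *)
Definition sym_basis : k.+1.-tuple (dhomog 2 F k) :=
  [tuple DHomog (monom_homog j) | j < k.+1].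

Lemma mcoeff_sym_basis (i j : 'I_k.+1) :
  (sym_basis`_j : {mpoly F[2]})@_(U_(0) *+ (k - i) + U_(1) *+ i) = (i == j)%:R.
Proof.
rewrite -tnth_nth tnth_mktuple /= !mpolyXn -mpolyXD mcoeffX.
congr (nat_of_bool _)%:R; apply/eqP/eqP => [/mnmP/(_ 1)|->//].
by rewrite !mnmDE !mulmnE !mnm1E !eqxx /= !mul0n !mul1n => /val_inj.
Qed.

Lemma sym_basisP : basis_of fullv sym_basis.
Proof.
have free_b : free sym_basis.
  apply/freeP => c c0 i; have /(congr1 (fun p : dhomog 2 F k =>
    (p : {mpoly F[2]})@_(U_(0) *+ (k - i) + U_(1) *+ i))) := c0.
  rewrite /= !raddf_sum /= mcoeff0 (bigD1 i) //= mcoeffZ mcoeff_sym_basis.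
  rewrite eqxx mulr1 big1 ?addr0 // => j ji.
  by rewrite mcoeffZ mcoeff_sym_basis eq_sym (negPf ji) mulr0.
rewrite basisEfree free_b subvf dimvf size_tuple /=.
by rewrite /dim /= addn1 binSn leqnn.
Qed.

(* Column j holds the coordinates of A . P_j. *)
Definition sym_pow (A : 'M[F]_2) : 'M[F]_k.+1 :=
  \matrix_(i, j) coord sym_basis i (sym_act A sym_basis`_j).

End SymmetricPower.

(* Main.v *)
Require Import Defs.
From mathcomp Require Import all_boot all_order all_algebra.
From mathcomp Require Import mpoly complex reals.
From mathcomp Require Import ring zify.
Import Order.TTheory GRing.Theory Num.Theory.

Set Implicit Arguments.
Unset Strict Implicit.
Unset Printing Implicit Defensive.

Local Open Scope ring_scope.

(** Write T = a + d and D = ad - bc.  The diagonal entry of S^k A at P_j is the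
    coefficient of x^(k-j) y^j in (ax + cy)^(k-j) (bx + dy)^j.  Choosing the
    term c y in i of the first factors forces the choice of b x in i of the
    others, and this gives the sum over j and i ([trace_sym_pow]).  Putting
    s = i and m = j - i turns it into the sum over s and m
    ([sum_diagonal_reindex]).

    The other two formulas are obtained by showing that every expression is the
    sequence u_0 = 1, u_1 = T, u_(k+2) = T u_(k+1) - D u_k, whose generating
    function is 1 / (1 - Tt + Dt^2).
    - For the sum in T and D this is Pascal's rule ([lucas_trdet]).
    - For the sum in a, b, c, d, the generating function is the geometric series
      in bc t^2 that comes from
        1 - Tt + Dt^2 = (1 - at)(1 - dt) - bc t^2,
      namely the sum over s of (bc t^2)^s / ((1 - at)(1 - dt))^(s+1).  The
      inner sum over m is a coefficient of 1 / ((1 - at)(1 - dt))^(s+1), and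
      multiplying by 1 - at or by 1 - dt lowers one exponent; this is again
      Pascal's rule ([geom_convSl], [geom_convSr], [lucas_entries]).
    - For the closed form, x = T (1 + r) / 2 and y = T (1 - r) / 2 have sum T and
      product D, so that (x - y) u_k = x^(k+1) - y^(k+1) ([lucas_binet]), where
      x - y = T r ([lucas_closed_form]). *)

(** * Second-order linear recurrences *)

Section Recurrence.
Variable R : comNzRingType.

(** The Lucas sequence of the first kind with parameters T and D, shifted by one
    index so that it starts with 1, T. *)
Definition lucas (T D : R) (u : nat -> R) :=
  [/\ u 0 = 1, u 1 = T & forall k, u k.+2 = T * u k.+1 - D * u k].

Lemma lucas_ind2 (P : nat -> Prop) :
  P 0 -> P 1 -> (forall k, P k -> P k.+1 -> P k.+2) -> forall k, P k.
Proof.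
move=> P0 P1 PS k; suff: P k /\ P k.+1 by case.
by elim: k => [//|k [IH1 IH2]]; split=> //; apply: PS.
Qed.

Lemma lucas_unique T D u v : lucas T D u -> lucas T D v -> u =1 v.
Proof.
move=> [u0 u1 uS] [v0 v1 vS]; apply: lucas_ind2; rewrite ?u0 ?u1 ?v0 ?v1 //.
by move=> k e0 e1; rewrite uS vS e0 e1.
Qed.

Lemma lucas_binet x y u k :
  lucas (x + y) (x * y) u -> (x - y) * u k = x ^+ k.+1 - y ^+ k.+1.
Proof.
move=> [u0 u1 uS]; move: k; apply: lucas_ind2 => [||k e0 e1].
- by rewrite u0 mulr1 !expr1.
- by rewrite u1; ring.
rewrite uS mulrBr mulrCA e1 [X in _ - X]mulrCA e0 !exprS; ring.
Qed.

Definition half_sum (u : nat -> nat -> R) k := \sum_(0 <= s < (k %/ 2).+1) u s k.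

(** A recurrence for triangular arrays that shifts the row index s by one when k
    drops by two is inherited by the sums over s: the bound k / 2 moves by
    exactly one under the same shift, and the vanishing hypothesis makes the
    remaining bounds interchangeable. *)
Lemma half_sum_rec (al be ga : R) (u : nat -> nat -> R) :
    (forall s k, (k < 2 * s)%N -> u s k = 0) ->
    (forall k, u 0 k.+2 = al * u 0 k.+1 + be * u 0 k) ->
    (forall s k, u s.+1 k.+2 = al * u s.+1 k.+1 + be * u s.+1 k + ga * u s k) ->
  forall k, half_sum u k.+2 = al * half_sum u k.+1 + (be + ga) * half_sum u k.
Proof.
move=> u_gt u0 uS k.
have widen n N : (n <= N)%N -> half_sum u n = \sum_(0 <= s < (N %/ 2).+1) u s n.
  move=> nN; rewrite /half_sum.
  rewrite (big_cat_nat _ (n := (n %/ 2).+1) (p := (N %/ 2).+1)) //=; last by lia.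
  rewrite [X in _ = _ + X]big_nat_cond [X in _ = _ + X]big1 ?addr0 // => s.
  by move=> ?; apply: u_gt; lia.
rewrite (widen k.+1 k.+2) // mulrDl {1}(widen k k.+2); last by lia.
rewrite /half_sum (_ : (k.+2 %/ 2) = (k %/ 2).+1)%N; last by lia.
rewrite big_nat_recl // [in X in al * X]big_nat_recl //.
rewrite [in X in be * X]big_nat_recl //.
rewrite u0 (eq_bigr _ (fun s _ => uS s k)) !big_split /= -!big_distrr /=; ring.
Qed.

End Recurrence.

Lemma lucas_closed_form (F : fieldType) (T D r : F) u k :
    2 != 0 :> F -> T != 0 -> r ^+ 2 = 1 - 4 * D / T ^+ 2 -> r != 0 ->
    lucas T D u ->
  u k = 1 / 2 * (T / 2) ^+ k * (((1 + r) ^+ k.+1 - (1 - r) ^+ k.+1) / r).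
Proof.
move=> two0 T0 r2 r0 u_lucas.
pose x := T / 2 * (1 + r); pose y := T / 2 * (1 - r).
have xyT : x + y = T by rewrite /x /y; field.
have xyD : x * y = D.
  have -> : x * y = (T / 2) ^+ 2 * (1 - r ^+ 2) by rewrite /x /y; ring.
  by rewrite r2; field; rewrite T0.
have binet : (x - y) * u k = x ^+ k.+1 - y ^+ k.+1.
  by apply: lucas_binet; rewrite xyT xyD.
have xyr : x - y = T * r by rewrite /x /y; field.
apply: (mulfI (mulf_neq0 T0 r0)); rewrite -{1}xyr binet /x /y.
rewrite !(exprMn _ (T / 2)) -mulrBr (exprS (T / 2)).
set P := _ - _; set Q := (T / 2) ^+ k; field.
by rewrite two0 r0.
Qed.

(** * The sum over powers of trace and determinant *)

Section Sums.
Variable R : comNzRingType.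

(** The i-th term at k + 2 splits, by Pascal's rule for C(k - i, i), into T times
    the i-th term at k + 1 and -D times the (i-1)-st term at k.  Truncated
    subtraction in the exponent of T is harmless because the binomial vanishes
    whenever k < 2i. *)
Lemma lucas_trdet (T D : R) :
  lucas T D (half_sum (fun i k =>
    (-1) ^+ i * 'C(k - i, i)%:R * T ^+ (k - 2 * i) * D ^+ i)).
Proof.
split=> [||k].
- by rewrite /half_sum big_nat1 bin0; ring.
- by rewrite /half_sum big_nat1 bin0; ring.
rewrite (half_sum_rec (al := T) (be := 0) (ga := - D)) ?add0r ?mulNr //.
- move=> s n sn; rewrite bin_small; last by lia.
  by ring.
- by move=> n; rewrite !subn0 !bin0 exprS; ring.
move=> s n; rewrite mul0r addr0.
have -> : (n.+2 - 2 * s.+1 = n - 2 * s)%N by lia.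
have -> : (n.+1 - s.+1 = n - s)%N by lia.
have [sn|ns] := leqP s n; last first.
  rewrite !bin_small; try by lia.
  by ring.
have -> : (n.+2 - s.+1 = (n - s).+1)%N by lia.
rewrite binS natrD.
have [ns|sn2] := ltnP n (2 * s).+1.
  rewrite (@bin_small (n - s) s.+1); last by lia.
  by rewrite !exprS; ring.
have -> : (n - 2 * s = (n.+1 - 2 * s.+1).+1)%N by lia.
by rewrite !exprS; ring.
Qed.

(** * The sum over exponents of the four entries *)

(** The coefficient of t^n in (1 - t)^(-s).  The case s = 0 is included:
    C(n - 1, n) with truncated predecessor is 1 at n = 0 and 0 afterwards, so that
    Pascal's rule holds down to the constant series 1. *)
Definition multichoose s n := 'C((s + n).-1, n).

Lemma multichoose0 s : multichoose s 0 = 1%N.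
Proof. by rewrite /multichoose bin0. Qed.

Lemma multichooseS s n :
  multichoose s.+1 n.+1 = (multichoose s.+1 n + multichoose s n.+1)%N.
Proof. by rewrite /multichoose !addSn !addnS /= binS addnC. Qed.

(** The coefficient of t^N in (1 - at)^(-p) (1 - dt)^(-q). *)
Definition geom_conv (a d : R) p q N : R :=
  \sum_(0 <= m < N.+1)
    (multichoose p (N - m))%:R * (multichoose q m)%:R * a ^+ (N - m) * d ^+ m.

Lemma geom_conv0 a d p q : geom_conv a d p q 0 = 1.
Proof. by rewrite /geom_conv big_nat1 subnn !multichoose0 !mul1r. Qed.

Lemma geom_conv00 a d N : geom_conv a d 0 0 N.+1 = 0.
Proof.
rewrite /geom_conv big_nat big1 // => -[|m] _.
  by rewrite /multichoose add0n subn0 /= bin_small // !mul0r.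
by rewrite /multichoose add0n [X in _ * X%:R]bin_small // mulr0 !mul0r.
Qed.

(** Multiplication of the series by 1 - at lowers the first exponent. *)
Lemma geom_convSl a d p q N :
  geom_conv a d p.+1 q N.+1 = a * geom_conv a d p.+1 q N + geom_conv a d p q N.+1.
Proof.
rewrite /geom_conv big_nat_recr //= [in X in _ = _ + X]big_nat_recr //=.
rewrite subnn !multichoose0 addrA; congr (_ + _).
rewrite big_distrr -big_split /= !big_nat; apply: eq_bigr => m ltmN.
rewrite subSn; last by lia.
by rewrite multichooseS natrD exprS; ring.
Qed.

Lemma geom_convC a d p q N : geom_conv a d p q N = geom_conv d a q p N.
Proof.
rewrite /geom_conv big_nat_rev /= add0n !big_nat; apply: eq_bigr => m ltmN.
rewrite subSS subKn; last by lia.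
by ring.
Qed.

Lemma geom_convSr a d p q N :
  geom_conv a d p q.+1 N.+1 = d * geom_conv a d p q.+1 N + geom_conv a d p q N.+1.
Proof. by rewrite geom_convC geom_convSl !(geom_convC d). Qed.

Lemma geom_convSS1 a d s :
  geom_conv a d s.+1 s.+1 1 = (a + d) + geom_conv a d s s 1.
Proof. by rewrite geom_convSl geom_convSr !geom_conv0; ring. Qed.

(** Multiplying by (1 - at)(1 - dt) lowers both exponents: both factors are
    peeled off in turn, and the intermediate value with exponents s and s + 1 is
    eliminated by a second use of the first step, one degree lower. *)
Lemma geom_convSS a d s N :
  geom_conv a d s.+1 s.+1 N.+2 = (a + d) * geom_conv a d s.+1 s.+1 N.+1
    - a * d * geom_conv a d s.+1 s.+1 N + geom_conv a d s s N.+2.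
Proof.
rewrite geom_convSl (geom_convSr a d s s).
have -> : geom_conv a d s s.+1 N.+1 =
  geom_conv a d s.+1 s.+1 N.+1 - a * geom_conv a d s.+1 s.+1 N.
  by rewrite geom_convSl; ring.
ring.
Qed.

(** The part of the trace in which the product bc occurs to the power s.  The
    explicit zero keeps the truncated difference k - 2s, for k < 2s, from
    contributing to the recurrence between the rows. *)
Definition entry_term (a b c d : R) s k :=
  if (2 * s <= k)%N then (b * c) ^+ s * geom_conv a d s.+1 s.+1 (k - 2 * s)
  else 0.

(** The rows s satisfy
      w_(s+1)(k+2) = (a + d) w_(s+1)(k+1) - ad w_(s+1)(k) + bc w_s(k),
    so the sum over s absorbs bc into the coefficient of the k-th value, which
    becomes -(ad - bc). *)
Lemma lucas_entries (a b c d : R) :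
  lucas (a + d) (a * d - b * c) (half_sum (entry_term a b c d)).
Proof.
split=> [||k].
- by rewrite /half_sum big_nat1 /entry_term muln0 leq0n geom_conv0; ring.
- rewrite /half_sum big_nat1 /entry_term muln0 leq0n geom_convSS1.
  by rewrite geom_conv00; ring.
rewrite (half_sum_rec (al := a + d) (be := - (a * d)) (ga := b * c)).
- by ring.
- by move=> s n lt; rewrite /entry_term leqNgt lt.
- by move=> n; rewrite /entry_term muln0 !leq0n !subn0 geom_convSS geom_conv00; ring.
move=> s n; rewrite /entry_term.
have -> : (2 * s.+1 <= n.+2)%N = (2 * s <= n)%N by lia.
have -> : (n.+2 - 2 * s.+1 = n - 2 * s)%N by lia.
have [le|lt] := leqP (2 * s) n; last first.
  rewrite !(leqNgt (2 * s.+1)).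
  have -> : (n.+1 < 2 * s.+1)%N by lia.
  have -> : (n < 2 * s.+1)%N by lia.
  by rewrite !mulr0 !addr0.
(* The identity between power series involves a degree and the two below it, so
   the degrees 0 and 1 are handled apart. *)
have [N ->] : exists N, n = (2 * s + N)%N by exists (n - 2 * s)%N; lia.
rewrite !addKn; case: N => [|[|N]].
- have -> : (2 * s.+1 <= (2 * s + 0).+1)%N = false by lia.
  have -> : (2 * s.+1 <= 2 * s + 0)%N = false by lia.
  by rewrite !geom_conv0 exprS; ring.
- have -> : (2 * s.+1 <= (2 * s + 1).+1)%N = true by lia.
  have -> : (2 * s.+1 <= 2 * s + 1)%N = false by lia.
  have -> : ((2 * s + 1).+1 - 2 * s.+1 = 0)%N by lia.
  by rewrite geom_convSS1 geom_conv0 exprS; ring.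
have -> : (2 * s.+1 <= (2 * s + N.+2).+1)%N = true by lia.
have -> : (2 * s.+1 <= 2 * s + N.+2)%N = true by lia.
have -> : ((2 * s + N.+2).+1 - 2 * s.+1 = N.+1)%N by lia.
have -> : (2 * s + N.+2 - 2 * s.+1 = N)%N by lia.
by rewrite geom_convSS exprS; ring.
Qed.

Lemma half_sum_entries (a b c d : R) k :
  half_sum (entry_term a b c d) k =
    \sum_(0 <= s < (k %/ 2).+1) \sum_(0 <= m < (k - 2 * s).+1)
      'C(k - s - m, s)%:R * 'C(m + s, m)%:R
        * a ^+ (k - 2 * s - m) * b ^+ s * c ^+ s * d ^+ m.
Proof.
rewrite /half_sum !big_nat; apply: eq_bigr => s lts.
have le : (2 * s <= k)%N by lia.
rewrite /entry_term le /geom_conv big_distrr /= !big_nat.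
apply: eq_bigr => m ltm; rewrite /multichoose !addSn /=.
have -> : (s + (k - 2 * s - m) = k - s - m)%N by lia.
rewrite -(@bin_sub (k - s - m) s); last by lia.
have -> : (k - s - m - s = k - 2 * s - m)%N by lia.
by rewrite (addnC m) exprMn; ring.
Qed.

(** Both sides run over the pairs (s, m) with 2s + m <= k: on the left, s = i and
    m = j - i. *)
Lemma sum_diagonal_reindex k (F : nat -> nat -> R) :
  \sum_(0 <= j < k.+1) \sum_(0 <= i < (minn (k - j) j).+1) F i (j - i)%N =
  \sum_(0 <= s < (k %/ 2).+1) \sum_(0 <= m < (k - 2 * s).+1) F s m.
Proof.
transitivity (\sum_(0 <= j < k.+1)
    \sum_(0 <= i < (k %/ 2).+1 | (i <= minn (k - j) j)%N) F i (j - i)%N).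
  rewrite !big_nat; apply: eq_bigr => j ltj.
  rewrite (big_nat_widen 0 _ (k %/ 2).+1); last by lia.
  by apply: eq_bigl => i; lia.
rewrite (exchange_big_dep_nat xpredT) //= !big_nat; apply: eq_bigr => s lts.
transitivity (\sum_(s <= j < (k - s).+1) F s (j - s)%N); last first.
  rewrite -{1}(add0n s) big_addn.
  rewrite (_ : (k - s).+1 - s = (k - 2 * s).+1)%N; last by lia.
  by apply: eq_bigr => m _; rewrite addnK.
rewrite [RHS](big_nat_widen _ _ k.+1); last by lia.
rewrite [RHS](big_nat_widenl _ 0) //.
rewrite big_nat_cond [RHS]big_nat_cond; apply: eq_bigl => j; lia.
Qed.

End Sums.

(** * The diagonal of the symmetric power *)

Section Trace.
Variable F : fieldType.

Lemma coord_sym_basis k (i : 'I_k.+1) (v : dhomog 2 F k) :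
  coord (sym_basis F k) i v = (v : {mpoly F[2]})@_(U_(0) *+ (k - i) + U_(1) *+ i).
Proof.
have /coord_basis := sym_basisP F k => /(_ v (memvf v)) vE.
rewrite {2}vE raddf_sum /= raddf_sum /= (bigD1 i) //= mcoeffZ mcoeff_sym_basis.
rewrite eqxx mulr1 big1 ?addr0 // => j ji.
by rewrite mcoeffZ mcoeff_sym_basis eq_sym (negPf ji) mulr0.
Qed.

Lemma linear_form_exp (u v : F) p :
  (u *: 'X_0 + v *: 'X_1 : {mpoly F[2]}) ^+ p =
  \sum_(0 <= i < p.+1)
    ('C(p, i)%:R * u ^+ (p - i) * v ^+ i) *: 'X_[U_(0) *+ (p - i) + U_(1) *+ i].
Proof.
rewrite exprDn big_mkord; apply: eq_bigr => i _.
rewrite mpolyXD -!mpolyXn !exprZn -scalerAl -scalerAr scalerA.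
by rewrite -scaler_nat scalerA mulrA.
Qed.

(** Total degrees agree, so it is enough to compare the exponents of the second
    variable. *)
Lemma bimonomial_eq p q i l : (i <= p)%N -> (l <= q)%N ->
  ((U_(0%R) *+ (p - i) + U_(1%R) *+ i) + (U_(0%R) *+ (q - l) + U_(1%R) *+ l)
    == U_(0%R) *+ p + U_(1%R) *+ q :> 'X_{1..2})%MM = (i + l == q)%N.
Proof.
move=> leip lelq; apply/eqP/eqP => [/mnmP/(_ 1)|ilq].
  by rewrite !mnmDE !mulmnE !mnm1E !eqxx /= !mul0n !mul1n.
apply/mnmP => x; rewrite !mnmDE !mulmnE.
by rewrite addnACA -!mulnDr ilq (_ : p - i + (q - l) = p)%N //; lia.
Qed.

(** In (ax + cy)^(k-j) (bx + dy)^j, taking i factors c y from the first power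
    leaves j - i factors d y for the second one: the double sum over choices
    collapses to a single sum over i. *)
Lemma sym_pow_diag k (A : 'M[F]_2) (j : 'I_k.+1) :
  sym_pow k A j j = \sum_(0 <= i < (minn (k - j) j).+1)
    'C(k - j, i)%:R * 'C(j, j - i)%:R
      * A 0 0 ^+ (k - j - i) * A 0 1 ^+ i * A 1 0 ^+ i * A 1 1 ^+ (j - i).
Proof.
rewrite mxE -tnth_nth tnth_mktuple coord_sym_basis /=.
rewrite !mpolyXn -mpolyXD comp_mpolyX big_ord_recl big_ord1 /=.
rewrite !mnmDE !mulmnE !mnm1E !eqxx /= !(mul0n, mul1n, addn0, add0n).
rewrite /tnth /= !linear_form_exp big_distrlr /= raddf_sum /=.
rewrite (big_nat_widen 0 (minn (k - j) j).+1 (k - j).+1); last by lia.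
rewrite [RHS]big_mkcond /= !big_nat; apply: eq_bigr => i lti.
rewrite raddf_sum /= (eq_big_nat _ _ (F2 := fun l =>
  'C(k - j, i)%:R * A 0 0 ^+ (k - j - i) * A 1 0 ^+ i *
  ('C(j, l)%:R * A 0 1 ^+ (j - l) * A 1 1 ^+ l) * (i + l == j)%:R)); last first.
  move=> l ltl; rewrite -scalerAl -scalerAr scalerA -mpolyXD mcoeffZ mcoeffX.
  by rewrite bimonomial_eq //; lia.
case: ifP => [lei|ltj]; last first.
  rewrite big_nat big1 // => l ltl.
  by rewrite (_ : (i + l == j)%N = false) ?mulr0 //; lia.
rewrite (bigD1_seq (j - i)%N) ?iota_uniq //=; last by rewrite mem_index_iota; lia.
rewrite big1 ?addr0 => [|l nel]; last first.
  by rewrite (_ : (i + l == j)%N = false) ?mulr0 //; lia.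
rewrite (_ : (i + (j - i) == j)%N) ?mulr1; last by lia.
rewrite (_ : (j - (j - i) = i)%N); last by lia.
by ring.
Qed.

Lemma trace_sym_pow k (A : 'M[F]_2) :
  \tr (sym_pow k A) =
    \sum_(0 <= j < k.+1) \sum_(0 <= i < (minn (k - j) j).+1)
      'C(k - j, i)%:R * 'C(j, j - i)%:R
        * A 0 0 ^+ (k - j - i) * A 0 1 ^+ i * A 1 0 ^+ i * A 1 1 ^+ (j - i).
Proof.
by rewrite /mxtrace big_mkord; apply: eq_bigr => j _; apply: sym_pow_diag.
Qed.

End Trace.

Theorem corollary4p5 (R : realType) (k : nat) (A : 'M[R[i]]_2) :
  let a := A 0 0 in let b := A 0 1 in
  let c := A 1 0 in let d := A 1 1 in
  [/\ \tr (sym_pow k A) =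
        \sum_(0 <= i < (k %/ 2).+1)
          (-1) ^+ i * 'C(k - i, i)%:R
            * (a + d) ^+ (k - 2 * i) * (a * d - b * c) ^+ i,
      \tr (sym_pow k A) =
        \sum_(0 <= j < k.+1) \sum_(0 <= i < (minn (k - j) j).+1)
          'C(k - j, i)%:R * 'C(j, j - i)%:R
            * a ^+ (k - j - i) * b ^+ i * c ^+ i * d ^+ (j - i),
      \tr (sym_pow k A) =
        \sum_(0 <= s < (k %/ 2).+1) \sum_(0 <= m < (k - 2 * s).+1)
          'C(k - s - m, s)%:R * 'C(m + s, m)%:R
            * a ^+ (k - 2 * s - m) * b ^+ s * c ^+ s * d ^+ m
    & forall r : R[i],
        a + d != 0 ->
        r ^+ 2 = 1 - 4 * (a * d - b * c) / (a + d) ^+ 2 ->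
        r != 0 ->
        \tr (sym_pow k A) =
          1 / 2 * ((a + d) / 2) ^+ k
            * (((1 + r) ^+ k.+1 - (1 - r) ^+ k.+1) / r)].
Proof.
move=> a b c d.
have tr_exp : \tr (sym_pow k A) =
    \sum_(0 <= s < (k %/ 2).+1) \sum_(0 <= m < (k - 2 * s).+1)
      'C(k - s - m, s)%:R * 'C(m + s, m)%:R
        * a ^+ (k - 2 * s - m) * b ^+ s * c ^+ s * d ^+ m.
  rewrite trace_sym_pow -sum_diagonal_reindex !big_nat.
  apply: eq_bigr => j ltj; rewrite !big_nat; apply: eq_bigr => i lti.
  rewrite subnK; last by lia.
  have -> : (k - i - (j - i) = k - j)%N by lia.
  by have -> : (k - 2 * i - (j - i) = k - j - i)%N by lia.
have tr_half : \tr (sym_pow k A) = half_sum (entry_term a b c d) k.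
  by rewrite tr_exp half_sum_entries.
split=> //.
- by rewrite tr_half (lucas_unique (lucas_entries a b c d) (lucas_trdet _ _)).
- exact: trace_sym_pow.
move=> r T0 r2 r0; rewrite tr_half.
by apply: lucas_closed_form (lucas_entries a b c d); rewrite // pnatr_eq0.
Qed.
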